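(* Let $A,B\in\mathbb{M}_n$. Assume that there exist unitaries $U,V\in\mathbb{M}_n$ such that $$|A+B|_{\mathrm{qsym}}=U\,|A|_{\mathrm{qsym}}\,U^*+V\,|B|_{\mathrm{qsym}}\,V^*.$$ For $T\in\mathbb{M}_n$ define the block matrix $$\Gamma(T):=\frac{1}{\sqrt2}\begin{pmatrix}T\\ T^*\end{pmatrix}\in\mathbb{M}_{2n,n}.$$ Then there exists a partial isometry $W\in\mathbb{M}_{2n,n}$ such that $$\Gamma(A)=W\,|A|_{\mathrm{qsym}},\qquad \Gamma(B)=W\,|B|_{\mathrm{qsym}}.$$ Equivalently, $\Gamma(A)$ and $\Gamma(B)$ admit polar decompositions sharing a common partial isometry factor.
   Context: $\mathbb{M}_{m,n}$ is the space of $m\times n$ complex matrices and $\mathbb{M}_n=\mathbb{M}_{n,n}$. For a (possibly rectangular) matrix $X$, $|X|=(X^*X)^{1/2}$. For $Z\in\mathbb{M}_n$, $|Z|_{\mathrm{qsym}}=\left(\frac{Z^*Z+ZZ^*}{2}\right)^{1/2}$; thus $|\Gamma(Z)|=|Z|_{\mathrm{qsym}}$. A partial isometry is a matrix $W$ such that $W^*W$ is an orthogonal projection. ''Polar decomposition of $X$ with partial isometry factor $W$'' here means a factorization $X=W|X|$ with $W$ a partial isometry (the initial projection of $W$ is not required to equal the support projection of $|X|$). *)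

(* Defs.v *)
From mathcomp Require Import all_boot all_order all_algebra.
From mathcomp Require Import complex reals.

Set Implicit Arguments.
Unset Strict Implicit.
Unset Printing Implicit Defensive.

Import Order.TTheory GRing.Theory Num.Theory.
Local Open Scope ring_scope.
Local Open Scope sesquilinear_scope.

Section MatrixModulus.
Variable C : numClosedFieldType.

(* Over [C] the order relation [0 <= z] entails that [z] is real. *)
Definition psdmx n (A : 'M[C]_n) : Prop :=
  A \is hermsymmx /\ forall x : 'cV[C]_n, 0 <= (x ^t* *m A *m x) 0 0.

(* Functional calculus: if A = P^* diag(d) P with P unitary, then
   A^(1/2) = P^* diag(sqrt d) P.  Meaningful for [psdmx A] only; the lemmas
   [sqrtmx_psd], [sqrtmxK] and [sqrtmx_uniq] below show that it is then the
   unique positive semidefinite square root of A. *)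
Definition sqrtmx n (A : 'M[C]_n) : 'M[C]_n :=
  (spectralmx A) ^t* *m diag_mx (map_mx sqrtC (spectral_diag A))
    *m spectralmx A.

Definition absmx m n (X : 'M[C]_(m, n)) : 'M[C]_n := sqrtmx (X ^t* *m X).

Definition qsymmx n (Z : 'M[C]_n) : 'M[C]_n :=
  sqrtmx (2^-1 *: (Z ^t* *m Z + Z *m Z ^t*)).

Definition Gamma n (T : 'M[C]_n) : 'M[C]_(n + n, n) :=
  (sqrtC 2)^-1 *: col_mx T (T ^t*).

Definition orthoprojmx n (P : 'M[C]_n) : Prop :=
  P \is hermsymmx /\ P *m P = P.

Definition partial_isometry m n (W : 'M[C]_(m, n)) : Prop :=
  orthoprojmx (W ^t* *m W).

(* The initial projection W^* W need not be the support projection of |X|. *)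
Definition polar_factor m n (X W : 'M[C]_(m, n)) : Prop :=
  partial_isometry W /\ X = W *m absmx X.

Lemma trmxC_mul m n p (A : 'M[C]_(m, n)) (B : 'M[C]_(n, p)) :
  (A *m B) ^t* = B ^t* *m A ^t*.
Proof. by rewrite trmx_mul map_mxM. Qed.

Lemma trmxCZ m n (a : C) (A : 'M[C]_(m, n)) : (a *: A) ^t* = a^* *: A ^t*.
Proof. by rewrite linearZ /= map_mxZ. Qed.

Lemma hermmxP n (A : 'M[C]_n) : reflect (A = A ^t*) (A \is hermsymmx).
Proof.
apply: (iffP idP) => [/is_hermitianmxP|h]; first by rewrite expr0 scale1r.
by apply/is_hermitianmxP; rewrite expr0 scale1r.
Qed.

Lemma gram_ge0 m (y : 'cV[C]_m) : 0 <= (y ^t* *m y) 0 0.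
Proof.
rewrite mxE sumr_ge0 // => i _; rewrite !mxE mulrC; exact: mul_conjC_ge0.
Qed.

Lemma psdmx_gram m n (X : 'M[C]_(m, n)) : psdmx (X ^t* *m X).
Proof.
split; first by apply/hermmxP; rewrite trmxC_mul trmxCK.
move=> x; rewrite !mulmxA -trmxC_mul -mulmxA; exact: gram_ge0.
Qed.

Lemma spectralmxK n (A : 'M[C]_n) : spectralmx A *m (spectralmx A) ^t* = 1%:M.
Proof. exact/unitarymxP/spectral_unitarymx. Qed.

Lemma psdmx_spectral n (A : 'M[C]_n) : psdmx A ->
  A = (spectralmx A) ^t* *m diag_mx (spectral_diag A) *m spectralmx A.
Proof.
case=> /hermitian_normalmx/orthomx_spectralP eqA _.
by rewrite -(invmx_unitary (spectral_unitarymx A)).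
Qed.

Lemma psdmx_spectral_ge0 n (A : 'M[C]_n) i :
  psdmx A -> 0 <= spectral_diag A 0 i.
Proof.
move=> psdA; have /= := psdA.2 ((spectralmx A) ^t* *m (delta_mx i 0 : 'cV_n)).
rewrite {2}(psdmx_spectral psdA) trmxC_mul trmxCK.
set P := spectralmx A; set D := diag_mx _.
set e : 'cV[C]_n := delta_mx i 0.
have -> : e ^t* *m P *m (P ^t* *m D *m P) *m (P ^t* *m e) = e ^t* *m D *m e.
  rewrite !mulmxA -(mulmxA _ P (P ^t*)) spectralmxK mulmx1.
  by rewrite -(mulmxA _ P (P ^t*)) spectralmxK mulmx1.
rewrite /e trmx_delta map_delta_mx -rowE -colE !mxE eqxx mulr1n; exact: id.
Qed.

Lemma sqrtmxK n (A : 'M[C]_n) : psdmx A -> sqrtmx A *m sqrtmx A = A.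
Proof.
move=> psdA; rewrite {3}(psdmx_spectral psdA) /sqrtmx.
set P := spectralmx A; set D := diag_mx _.
rewrite !mulmxA -(mulmxA _ P (P ^t*)) spectralmxK mulmx1 -(mulmxA _ D D).
rewrite mulmx_diag; congr (_ *m diag_mx _ *m _).
by apply/rowP => i; rewrite !mxE -expr2 sqrtCK.
Qed.

Lemma sqrtmx_psd n (A : 'M[C]_n) : psdmx A -> psdmx (sqrtmx A).
Proof.
move=> psdA.
pose D : 'M[C]_n := diag_mx (map_mx (sqrtC \o sqrtC) (spectral_diag A)).
have dE : D ^t* = D.
  rewrite tr_diag_mx map_diag_mx; congr diag_mx; apply/rowP => i.
  by rewrite !mxE /= geC0_conj // !sqrtC_ge0 psdmx_spectral_ge0.
suff -> : sqrtmx A = (D *m spectralmx A) ^t* *m (D *m spectralmx A).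
  exact: psdmx_gram.
rewrite trmxC_mul dE !mulmxA -(mulmxA _ D D) mulmx_diag.
congr (_ *m diag_mx _ *m _).
by apply/rowP => i; rewrite !mxE /= -expr2 sqrtCK.
Qed.

Lemma tr_gram_ge0 m n (X : 'M[C]_(m, n)) : 0 <= \tr (X ^t* *m X).
Proof.
apply: sumr_ge0 => i _; rewrite mxE sumr_ge0 // => k _.
by rewrite !mxE mulrC mul_conjC_ge0.
Qed.

Lemma tr_gram_eq0 m n (X : 'M[C]_(m, n)) : \tr (X ^t* *m X) = 0 -> X = 0.
Proof.
move=> /eqP; rewrite psumr_eq0 => [/allP X0|i _]; last first.
  by rewrite mxE sumr_ge0 // => k _; rewrite !mxE mulrC mul_conjC_ge0.
apply/matrixP => i j; rewrite mxE; apply/eqP.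
have := X0 j; rewrite mem_index_enum => /(_ isT).
rewrite mxE psumr_eq0 => [/allP/(_ i)|k _].
  by rewrite mem_index_enum !mxE mulrC mul_conjC_eq0 => /(_ isT).
by rewrite !mxE mulrC mul_conjC_ge0.
Qed.

Lemma sqrtmx_uniq n (A S : 'M[C]_n) : psdmx S -> S *m S = A -> sqrtmx A = S.
Proof.
move=> psdS SA.
have hS : S ^t* = S by case: psdS => /hermmxP.
have psdA : psdmx A by rewrite -SA -{1}hS; exact: psdmx_gram.
have psdB := sqrtmx_psd psdA; set B := sqrtmx A in psdB *.
have hB : B ^t* = B by case: psdB => /hermmxP.
have BA : B *m B = A by exact: sqrtmxK.
pose D := B - S.
have hD : D ^t* = D by rewrite /D linearB /= map_mxB hB hS.
(* For D = B - S one has B D = - D S, so tr (D B D) + tr (D S D) = 0. *)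
have trE (T : 'M[C]_n) : psdmx T -> D *m T *m D =
    (sqrtmx T *m D) ^t* *m (sqrtmx T *m D).
  move=> psdT; have /hermmxP hT := (sqrtmx_psd psdT).1.
  rewrite trmxC_mul hD -hT -(mulmxA D (sqrtmx T)) (mulmxA (sqrtmx T) _ D).
  by rewrite sqrtmxK // mulmxA.
have BD : B *m D = - (D *m S).
  by rewrite mulmxBr mulmxBl BA SA opprB.
have tr0 : \tr (D *m B *m D) + \tr (D *m S *m D) = 0.
  by rewrite -mulmxA BD mulmxN raddfN /= mxtrace_mulC addNr.
move/eqP: tr0; rewrite !trE // paddr_eq0 ?tr_gram_ge0 //.
case/andP => /eqP/tr_gram_eq0 B0 /eqP/tr_gram_eq0 S0.
have BD0 : B *m D = 0 by rewrite -(sqrtmxK psdB) -mulmxA B0 mulmx0.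
have SD0 : S *m D = 0 by rewrite -(sqrtmxK psdS) -mulmxA S0 mulmx0.
apply/eqP; rewrite -subr_eq0; apply/eqP.
by apply: tr_gram_eq0; rewrite -/D hD {1}/D mulmxBl BD0 SD0 subr0 mxtrace0.
Qed.

Lemma absmx_Gamma n (Z : 'M[C]_n) : absmx (Gamma Z) = qsymmx Z.
Proof.
rewrite /absmx /qsymmx /Gamma; congr sqrtmx.
rewrite trmxCZ -scalemxAr -scalemxAl scalerA.
rewrite tr_col_mx map_row_mx mul_row_col trmxCK; congr (_ *: _).
by rewrite fmorphV /= geC0_conj ?sqrtC_ge0 ?ler0n // -invfM -expr2 sqrtCK.
Qed.

End MatrixModulus.

(* Main.v *)
Require Import Defs.
From mathcomp Require Import all_boot all_order all_algebra.
From mathcomp Require Import complex reals.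

Import Order.TTheory GRing.Theory Num.Theory.
Local Open Scope ring_scope.
Local Open Scope sesquilinear_scope.

(** With X = Gamma A and Y = Gamma B, let X + Y = W |X + Y| be the polar
    decomposition.  Taking traces in the hypothesis,
    tr |X| + tr |Y| = tr (W^* X) + tr (W^* Y), whereas
    Re tr (W^* Z) <= tr |Z| for every Z.  Equality therefore holds for both X
    and Y, and it forces Z = W |Z|: for Z = W1 |Z| and S = |Z|^(1/2), the
    Hilbert-Schmidt norm of (W - W1) S has square at most
    2 (tr |Z| - Re tr (W^* Z)). *)

Section PolarDecomposition.
Set Implicit Arguments.
Unset Strict Implicit.
Variable C : numClosedFieldType.

Lemma trmxCD m n (A B : 'M[C]_(m, n)) : (A + B) ^t* = A ^t* + B ^t*.
Proof. by rewrite linearD /= map_mxD. Qed.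

Lemma trmxCB m n (A B : 'M[C]_(m, n)) : (A - B) ^t* = A ^t* - B ^t*.
Proof. by rewrite linearB /= map_mxB. Qed.

Lemma trmxC1 n : (1%:M : 'M[C]_n) ^t* = 1%:M.
Proof. by rewrite trmx1 map_mx1. Qed.

Lemma mxtraceC n (A : 'M[C]_n) : \tr (A ^t*) = (\tr A)^*.
Proof. by rewrite trace_map_mx mxtrace_tr. Qed.

Lemma tr_gramB m n (X Y : 'M[C]_(m, n)) :
  \tr ((X - Y) ^t* *m (X - Y)) =
  \tr (X ^t* *m X) + \tr (Y ^t* *m Y) - (\tr (X ^t* *m Y) + \tr (Y ^t* *m X)).
Proof.
rewrite trmxCB mulmxBl !mulmxBr !(linearB (@mxtrace C n)).
by rewrite opprB addrACA opprD.
Qed.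

Lemma psdmx_trmxC n (A : 'M[C]_n) : psdmx A -> A ^t* = A.
Proof. by case=> /hermmxP. Qed.

Lemma absmx_psd m n (X : 'M[C]_(m, n)) : psdmx (absmx X).
Proof. exact/sqrtmx_psd/psdmx_gram. Qed.

Lemma absmxK m n (X : 'M[C]_(m, n)) : absmx X *m absmx X = X ^t* *m X.
Proof. exact/sqrtmxK/psdmx_gram. Qed.

(** The identities make [sqrtmx A *m G] the orthogonal projection onto the range of [sqrtmx A], so
    [G] can divide by |X| on its support. *)
Lemma sqrtmx_pinv n (A : 'M[C]_n) : psdmx A ->
  exists G : 'M[C]_n, [/\ G ^t* = G, G *m sqrtmx A = sqrtmx A *m G &
    sqrtmx A *m G *m sqrtmx A = sqrtmx A].
Proof.
move=> psdA; set P := spectralmx A.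
pose s := map_mx sqrtC (spectral_diag A).
pose conjP (d : 'rV[C]_n) := P ^t* *m diag_mx d *m P.
have conjPM d e : conjP d *m conjP e = conjP (\row_j (d 0 j * e 0 j)).
  rewrite /conjP !mulmxA -(mulmxA _ P (P ^t*)) spectralmxK mulmx1.
  by rewrite -(mulmxA _ (diag_mx d)) mulmx_diag.
have SE : sqrtmx A = conjP s by [].
(* Since 0^-1 = 0, this is the Moore-Penrose inverse of [sqrtmx A]. *)
exists (conjP (map_mx GRing.inv s)); rewrite SE; split.
- rewrite /conjP !trmxC_mul trmxCK mulmxA tr_diag_mx map_diag_mx.
  congr (_ *m diag_mx _ *m _); apply/rowP => j; rewrite !mxE fmorphV /=.
  by rewrite geC0_conj // sqrtC_ge0 psdmx_spectral_ge0.
- rewrite !conjPM; congr conjP; apply/rowP => j; by rewrite !mxE mulrC.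
- rewrite !conjPM; congr conjP; apply/rowP => j; rewrite !mxE.
  by have [->|?] := eqVneq (sqrtC (spectral_diag A 0 j)) 0;
    rewrite ?mulr0 // mulfV // mul1r.
Qed.

Lemma polar_decomposition m n (X : 'M[C]_(m, n)) :
  exists W : 'M[C]_(m, n),
    polar_factor X W /\ W ^t* *m W *m absmx X = absmx X.
Proof.
have psdX := psdmx_gram X.
have [G [hG cG GK]] := sqrtmx_pinv psdX.
have hS := psdmx_trmxC (absmx_psd X); have SS := absmxK X.
rewrite -/(absmx X) in cG GK; rewrite /polar_factor.
move: (absmx X) hS SS cG GK => S hS SS cG GK.
(* The factor is [X *m G], whose initial projection [S *m G] is the support projection of [S]. *)
have WW : (X *m G) ^t* *m (X *m G) = S *m G.
  by rewrite trmxC_mul hG mulmxA -(mulmxA G) -SS mulmxA cG GK.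
exists (X *m G); rewrite /partial_isometry /orthoprojmx WW.
split=> //; split.
  by split; [apply/hermmxP; rewrite trmxC_mul hS hG | rewrite mulmxA GK].
(* [X] vanishes wherever [S] does, since X^* X = S^2; [1%:M - G *m S] maps into the kernel of
   [S]. *)
apply/eqP; rewrite -subr_eq0; apply/eqP; apply: tr_gram_eq0.
have -> : X - X *m G *m S = X *m (1%:M - G *m S).
  by rewrite mulmxBr mulmx1 mulmxA.
have SK : S *m (1%:M - G *m S) = 0 by rewrite mulmxBr mulmx1 mulmxA GK subrr.
by rewrite trmxC_mul mulmxA -(mulmxA _ (X ^t*)) -SS -!mulmxA SK !mulmx0 mxtrace0.
Qed.

(** The difference of the two sides is the squared Hilbert-Schmidt norm of (1 - W^* W) M, because 1
    - W^* W is again an orthogonal projection. *)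
Lemma partial_isometry_tr_le m n p (W : 'M[C]_(m, n)) (M : 'M[C]_(n, p)) :
  partial_isometry W -> \tr ((W *m M) ^t* *m (W *m M)) <= \tr (M ^t* *m M).
Proof.
rewrite trmxC_mul mulmxA -(mulmxA _ (W ^t*)) /partial_isometry.
move: (W ^t* *m W) => E [/hermmxP hE EE]; rewrite -subr_ge0 -linearB /=.
suff -> : M ^t* *m M - M ^t* *m E *m M =
    ((1%:M - E) *m M) ^t* *m ((1%:M - E) *m M) by exact: tr_gram_ge0.
have FF : (1%:M - E) ^t* *m (1%:M - E) = 1%:M - E.
  rewrite trmxCB trmxC1 -hE mulmxBr mulmx1 mulmxBl mul1mx EE.
  by rewrite subrr subr0.
rewrite trmxC_mul mulmxA -(mulmxA _ (_ ^t*) (_ - _)) FF.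
by rewrite mulmxBr mulmx1 mulmxBl.
Qed.

Lemma tr_polar_le m n (W X : 'M[C]_(m, n)) : partial_isometry W ->
  let t := \tr (W ^t* *m X) in
  t + t^* <= \tr (absmx X) *+ 2 /\
  (t + t^* = \tr (absmx X) *+ 2 -> X = W *m absmx X).
Proof.
move=> pW t; have [W1 [[pW1 XE] _]] := polar_decomposition X.
have psdP := absmx_psd X.
move: (absmx X) XE psdP => P XE psdP.
have [S hS SS] : exists2 S : 'M[C]_n, S ^t* = S & S *m S = P.
  by exists (sqrtmx P); [exact/psdmx_trmxC/sqrtmx_psd | exact: sqrtmxK].
(* Cyclicity of the trace turns [t] into a Hilbert-Schmidt inner product, so t + t^* is the cross
   term of the squared distance from [W *m S] to [W1 *m S]. *)
have tE : t = \tr ((W *m S) ^t* *m (W1 *m S)).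
  by rewrite /t {1}XE -SS trmxC_mul hS -mulmxA [RHS]mxtrace_mulC !mulmxA.
have tCE : t^* = \tr ((W1 *m S) ^t* *m (W *m S)).
  by rewrite tE -mxtraceC (trmxC_mul (_ ^t*)) trmxCK.
have gapE : \tr ((W *m S - W1 *m S) ^t* *m (W *m S - W1 *m S)) =
    \tr ((W *m S) ^t* *m (W *m S)) + \tr ((W1 *m S) ^t* *m (W1 *m S))
    - (t + t^*).
  by rewrite tr_gramB -tE -tCE.
have gap_le : \tr ((W *m S - W1 *m S) ^t* *m (W *m S - W1 *m S)) <=
    \tr P *+ 2 - (t + t^*).
  have -> : P = S ^t* *m S by rewrite hS SS.
  by rewrite gapE lerD2r mulr2n lerD ?partial_isometry_tr_le.
split; first by rewrite -subr_ge0 (le_trans _ gap_le) ?tr_gram_ge0.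
(* Equality forces [W *m S = W1 *m S]; one more factor [S] on the right gives W P = W1 P = X. *)
move=> t_eq; rewrite t_eq subrr in gap_le.
have /tr_gram_eq0/eqP : \tr ((W *m S - W1 *m S) ^t* *m (W *m S - W1 *m S)) = 0.
  by apply/eqP; rewrite eq_le gap_le tr_gram_ge0.
by rewrite subr_eq0 => /eqP WS; rewrite XE -SS !(mulmxA _ S S) WS.
Qed.

Lemma mxtrace_unitary_conj n (U A : 'M[C]_n) :
  U \is unitarymx -> \tr (U *m A *m U ^t*) = \tr A.
Proof.
by move=> Uu; rewrite mxtrace_mulC mulmxA -invmx_unitary // mulVmx
  ?mul1mx ?unitarymx_unit.
Qed.

Lemma common_polar_factor m n (X Y : 'M[C]_(m, n)) :
  \tr (absmx (X + Y)) = \tr (absmx X) + \tr (absmx Y) ->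
  exists W : 'M[C]_(m, n), polar_factor X W /\ polar_factor Y W.
Proof.
move=> trXY; have [W [[pW XYE] WK]] := polar_decomposition (X + Y).
have [leX eqX] := tr_polar_le X pW.
have [leY eqY] := tr_polar_le Y pW.
set tX := \tr (_ *m X) in leX eqX; set tY := \tr (_ *m Y) in leY eqY.
(* W^* (X + Y) = W^* W |X + Y| = |X + Y|, as W^* W fixes |X + Y|. *)
have tE : tX + tY = \tr (absmx X) + \tr (absmx Y).
  by rewrite -linearD -mulmxDr {1}XYE mulmxA WK.
have tCE : (tX + tY)^* = tX + tY.
  rewrite tE rmorphD /= -!mxtraceC.
  by rewrite !(psdmx_trmxC (absmx_psd _)).
have sumE : (tX + tX^*) + (tY + tY^*) = \tr (absmx X) *+ 2 + \tr (absmx Y) *+ 2.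
  by rewrite addrACA -rmorphD /= tCE tE -mulr2n mulrnDl.
(* The two sides of [leX] and [leY] have equal sums, so both inequalities are equalities. *)
exists W; split; split=> //; [apply: eqX | apply: eqY]; apply/eqP.
  by rewrite eq_le leX -(lerD2r (tY + tY^*)) sumE lerD2l.
by rewrite eq_le leY -(lerD2l (tX + tX^*)) sumE lerD2r.
Qed.

Lemma polar_factor_Gamma n (A : 'M[C]_n) W :
  polar_factor (Gamma A) W -> partial_isometry W /\ Gamma A = W *m qsymmx A.
Proof. by rewrite /polar_factor absmx_Gamma. Qed.

(** [Gamma] is additive and unitary conjugation preserves the trace, so the hypothesis yields
    equality in the trace-norm triangle inequality for [Gamma A] and [Gamma B]. *)
Lemma Gamma_common_polar_factor n (A B U V : 'M[C]_n) :
  U \is unitarymx -> V \is unitarymx ->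
  qsymmx (A + B) = U *m qsymmx A *m U ^t* + V *m qsymmx B *m V ^t* ->
  exists W : 'M[C]_(n + n, n),
    polar_factor (Gamma A) W /\ polar_factor (Gamma B) W.
Proof.
move=> Uu Vu absD; apply: common_polar_factor.
have -> : Gamma A + Gamma B = Gamma (A + B).
  by rewrite /Gamma -scalerDr add_col_mx trmxCD.
by rewrite !absmx_Gamma absD mxtraceD !mxtrace_unitary_conj.
Qed.

End PolarDecomposition.

Theorem theorem1p10 (R : realType) (n : nat) (A B : 'M[R[i]]_n)
  (hAB : exists U V : 'M[R[i]]_n,
    [/\ U \is unitarymx, V \is unitarymx &
      qsymmx (A + B) = U *m qsymmx A *m U ^t* + V *m qsymmx B *m V ^t*]) :
  (exists W : 'M[R[i]]_(n + n, n),
     [/\ partial_isometry W,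
         Gamma A = W *m qsymmx A &
         Gamma B = W *m qsymmx B]) /\
  (exists W : 'M[R[i]]_(n + n, n),
     polar_factor (Gamma A) W /\ polar_factor (Gamma B) W).
Proof.
have [U [V [Uu Vu absD]]] := hAB.
have [W [pA pB]] := Gamma_common_polar_factor Uu Vu absD.
have [pW eqA] := polar_factor_Gamma pA; have [_ eqB] := polar_factor_Gamma pB.
split; exists W; [exact (And3 pW eqA eqB) | exact (conj pA pB)].
Qed.
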